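(* Let $1\le p<\infty$. For every $\varepsilon>0$ and every pair $(F,G)\in(BV_p[0,1])^2$ there exists a pair of jointly nondegenerate functions $(F_1,G_1)\in(BV_p[0,1])^2$ such that $F\cdot G=F_1\cdot G_1$ (pointwise on $[0,1]$), $\|F-F_1\|_{BV_p}<\varepsilon$ and $\|G-G_1\|_{BV_p}<\varepsilon$.
   Context: For $1\le p<\infty$ and $f:[0,1]\to\mathbb F$, $\mathbb F\in\{\mathbb R,\mathbb C\}$, $\operatorname{Var}_p(f,[0,1]):=\sup\sum_{j=1}^m|f(t_j)-f(t_{j-1})|^p$ over all partitions $0=t_0<\dots<t_m=1$. $BV_p[0,1]$ is the set of $f$ with $\operatorname{Var}_p(f,[0,1])<\infty$, normed by $\|f\|_{BV_p}=\sup_{x\in[0,1]}|f(x)|+(\operatorname{Var}_p(f,[0,1]))^{1/p}$. Functions $F_1,G_1:[0,1]\to\mathbb F$ are jointly nondegenerate if $\inf_{x\in[0,1]}(|F_1(x)|+|G_1(x)|)>0$. *)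

(* Defs.v *)
From Stdlib Require Import Reals Lra Classical ClassicalEpsilon.
Open Scope R_scope.

(* x^p for x >= 0 and real p > 0, with the convention 0^p = 0
   (Rpower 0 p = exp (p * ln 0) is not 0 in Stdlib). *)
Definition powp (x p : R) : R := if Rle_dec x 0 then 0 else Rpower x p.

(* Supremum of a set of reals (classical); 0 if no least upper bound exists.
   Only used on nonempty bounded-above sets below. *)
Definition sup_R (A : R -> Prop) : R :=
  match excluded_middle_informative (exists l, is_lub A l) with
  | left H => proj1_sig (constructive_indefinite_description _ H)
  | right _ => 0
  end.

Definition Cpx : Type := (R * R)%type.
Definition Csub (z w : Cpx) : Cpx := (fst z - fst w, snd z - snd w).
Definition Cmul (z w : Cpx) : Cpx :=
  (fst z * fst w - snd z * snd w, fst z * snd w + snd z * fst w).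
Definition Cnorm (z : Cpx) : R := sqrt (fst z ^ 2 + snd z ^ 2).

Section Generic.
(* A scalar field K (R or C) given with subtraction and modulus. *)
Variable K : Type.
Variable sub : K -> K -> K.
Variable nm : K -> R.

Definition partition01 (t : nat -> R) (m : nat) : Prop :=
  t 0%nat = 0 /\ t m = 1 /\ forall i, (i < m)%nat -> t i < t (S i).

Definition psum (p : R) (f : R -> K) (t : nat -> R) (m : nat) : R :=
  sum_f_R0 (fun j => powp (nm (sub (f (t (S j))) (f (t j)))) p) (Nat.pred m).

Definition var_sums (p : R) (f : R -> K) (v : R) : Prop :=
  exists t m, partition01 t m /\ v = psum p f t m.

Definition Var_p (p : R) (f : R -> K) : R := sup_R (var_sums p f).

Definition BVp (p : R) (f : R -> K) : Prop :=
  exists M, forall v, var_sums p f v -> v <= M.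

Definition abs_vals (f : R -> K) (y : R) : Prop :=
  exists x, 0 <= x <= 1 /\ y = nm (f x).

Definition BVp_norm (p : R) (f : R -> K) : R :=
  sup_R (abs_vals f) + powp (Var_p p f) (1 / p).

Definition jointly_nondegenerate (F1 G1 : R -> K) : Prop :=
  exists d, 0 < d /\ forall x, 0 <= x <= 1 -> d <= nm (F1 x) + nm (G1 x).

End Generic.

Definition thm4p3_for (K : Type) (sub mul : K -> K -> K) (nm : K -> R)
  (p : R) : Prop :=
  forall eps : R, 0 < eps ->
  forall F G : R -> K, @BVp K sub nm p F -> @BVp K sub nm p G ->
  exists F1 G1 : R -> K,
    @BVp K sub nm p F1 /\ @BVp K sub nm p G1 /\
    @jointly_nondegenerate K nm F1 G1 /\
    (forall x, 0 <= x <= 1 -> mul (F x) (G x) = mul (F1 x) (G1 x)) /\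
    @BVp_norm K sub nm p (fun x => sub (F x) (F1 x)) < eps /\
    @BVp_norm K sub nm p (fun x => sub (G x) (G1 x)) < eps.

(* Main.v *)
(* Put r = |F| + |G| and let D be the distance between values of (F, G).

   Consider increasing sequences in which of any two consecutive points at least
   one has r <= d, weighted by sums of min(D, 2 d)^p. The supremum of these sums
   tends to 0 with d: otherwise every scale d admits a sequence of weight more
   than a fixed eta; inserting a sequence for a much smaller scale into one for a
   larger scale keeps the weight of the first and a factor 3^-p of the weight of
   the second, up to a negligible error, and iterating this contradicts the
   finiteness of the p-variation.

   Now call x bad if, scanning from the left, r has dropped below d / 2 and not
   come back to d since. On bad points set F1 = d and G1 = F G / d, and
   elsewhere F1 = F, G1 = G. Each change between bad and not bad costs O(d^p) in
   the p-variation of F - F1 and G - G1, but it also forces r to travel between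
   d / 2 and d, so the fact above bounds the number of changes, just as it bounds
   the variation over the bad points. *)
Require Import Defs.
From Stdlib Require Import Reals Lra Lia Classical ClassicalEpsilon.
From Coquelicot Require Complex.
Open Scope R_scope.

(** * Powers of nonnegative reals *)

Section PowerFunction.
Variable p : R.
Hypothesis p_gt0 : 0 < p.

Lemma powp_0 : powp 0 p = 0.
Proof. unfold powp; destruct (Rle_dec 0 0); lra. Qed.

Lemma powp_pos (x : R) : 0 < x -> 0 < powp x p.
Proof.
  intros Hx; unfold powp; destruct (Rle_dec x 0); [lra|].
  apply exp_pos.
Qed.

Lemma powp_ge0 (x : R) : 0 <= powp x p.
Proof.
  unfold powp; destruct (Rle_dec x 0); [lra|].
  left; apply exp_pos.
Qed.

Lemma powp_le (x y : R) : x <= y -> powp x p <= powp y p.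
Proof.
  intros Hxy; destruct (Rle_dec x 0) as [Hx|Hx].
  - replace (powp x p) with 0; [apply powp_ge0|].
    unfold powp; destruct (Rle_dec x 0); lra.
  - unfold powp; destruct (Rle_dec x 0); [lra|]; destruct (Rle_dec y 0); [lra|].
    apply Rle_Rpower_l; lra.
Qed.

Lemma powp_mul (x y : R) :
  0 <= x -> 0 <= y -> powp (x * y) p = powp x p * powp y p.
Proof.
  intros [Hx|<-] [Hy|<-]; rewrite ?Rmult_0_l, ?Rmult_0_r, ?powp_0; try ring.
  unfold powp.
  assert (0 < x * y) by (apply Rmult_lt_0_compat; lra).
  destruct (Rle_dec (x * y) 0); [lra|]; destruct (Rle_dec x 0); [lra|].
  destruct (Rle_dec y 0); [lra|].
  now rewrite Rpower_mult_distr.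
Qed.

Lemma powp_scale_le (k x y : R) :
  0 <= k -> 0 <= y -> x <= k * y -> powp x p <= powp k p * powp y p.
Proof. intros Hk Hy H; rewrite <- powp_mul; auto; now apply powp_le. Qed.

(** The largest of [a], [b], [c] is at least [x / 3], whence the constant [powp 3 p]. *)
Lemma powp_add3_le (x a b c : R) :
  0 <= a -> 0 <= b -> 0 <= c -> x <= a + b + c ->
  powp x p <= powp 3 p * (powp a p + powp b p + powp c p).
Proof.
  intros Ha Hb Hc H.
  assert (Hm : forall m, 0 <= m -> x <= 3 * m -> powp x p <= powp 3 p * powp m p)
    by (intros m Hm Hx; apply powp_scale_le; lra).
  pose proof (powp_ge0 a); pose proof (powp_ge0 b); pose proof (powp_ge0 c).
  pose proof (powp_ge0 3).
  destruct (Rle_dec b a); destruct (Rle_dec c a); destruct (Rle_dec c b);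
    first [ apply Rle_trans with (1 := Hm a Ha ltac:(lra))
          | apply Rle_trans with (1 := Hm b Hb ltac:(lra))
          | apply Rle_trans with (1 := Hm c Hc ltac:(lra)) ];
    apply Rmult_le_compat_l; lra.
Qed.

Lemma powp_add_le (x a b : R) :
  0 <= a -> 0 <= b -> x <= a + b ->
  powp x p <= powp 3 p * (powp a p + powp b p).
Proof.
  intros Ha Hb H.
  replace (powp a p + powp b p) with (powp a p + powp b p + powp 0 p)
    by (rewrite powp_0; ring).
  apply powp_add3_le; lra.
Qed.

Lemma powp_root (x : R) : 0 <= x -> powp (powp x p) (1 / p) = x.
Proof.
  intros [Hx|<-].
  - pose proof (powp_pos x Hx) as Hpos.
    unfold powp at 1; destruct (Rle_dec (powp x p) 0); [lra|].
    unfold powp; destruct (Rle_dec x 0); [lra|].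
    rewrite Rpower_mult; replace (p * (1 / p)) with 1 by (field; lra).
    now apply Rpower_1.
  - rewrite powp_0; unfold powp; destruct (Rle_dec 0 0); lra.
Qed.

Lemma powp_3_inv : 0 < / powp 3 p <= 1.
Proof.
  assert (H3 : 1 <= powp 3 p).
  { unfold powp; destruct (Rle_dec 3 0); [lra|].
    rewrite <- (Rpower_O 3) by lra; apply Rle_Rpower; lra. }
  split; [apply Rinv_0_lt_compat; lra|].
  rewrite <- Rinv_1 at 1; apply Rinv_le_contravar; lra.
Qed.

Lemma powp_small (c eta d0 : R) : 0 <= c -> 0 < eta -> 0 < d0 ->
  exists d, 0 < d <= d0 /\ c * powp d p <= eta.
Proof.
  intros Hc Heta Hd0.
  (* Adding 1 keeps the denominator positive when [c = 0]; the witness is the [p]-th root of [y],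
     capped by [d0]. *)
  set (y := eta / (c + 1)).
  assert (Hy : 0 < y) by (apply Rdiv_lt_0_compat; lra).
  set (d := Rpower y (1 / p)).
  assert (Hd : 0 < d) by apply exp_pos.
  assert (Hdp : powp d p = y).
  { unfold powp; destruct (Rle_dec d 0); [lra|]; unfold d.
    rewrite Rpower_mult; replace (1 / p * p) with 1 by (field; lra).
    now apply Rpower_1. }
  exists (Rmin d d0); split.
  - split; [now apply Rmin_glb_lt|apply Rmin_r].
  - apply Rle_trans with (c * y).
    + apply Rmult_le_compat_l; [lra|]; rewrite <- Hdp.
      apply powp_le, Rmin_l.
    + unfold y; apply Rmult_le_reg_r with (c + 1); [lra|].
      replace (c * (eta / (c + 1)) * (c + 1)) with (c * eta) by (field; lra).
      nra.
Qed.

End PowerFunction.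

(** * Finite sums and weighted chains of points *)

Fixpoint rsum (f : nat -> R) (n : nat) : R :=
  match n with O => 0 | S k => rsum f k + f k end.

Lemma sum_f_R0_rsum (f : nat -> R) (n : nat) :
  sum_f_R0 f n = rsum f (S n).
Proof. induction n as [|n IH]; simpl in *; [ring|now rewrite IH]. Qed.

Lemma rsum_le (f g : nat -> R) (n : nat) :
  (forall i, (i < n)%nat -> f i <= g i) -> rsum f n <= rsum g n.
Proof.
  induction n as [|n IH]; simpl; intros H; [lra|].
  apply Rplus_le_compat; [apply IH; intros; apply H; lia|apply H; lia].
Qed.

Lemma rsum_eq (f g : nat -> R) (n : nat) :
  (forall i, (i < n)%nat -> f i = g i) -> rsum f n = rsum g n.
Proof.
  induction n as [|n IH]; simpl; intros H; [lra|].
  f_equal; [apply IH; intros; apply H; lia|apply H; lia].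
Qed.

Lemma rsum_lin (a b : R) (f g : nat -> R) (n : nat) :
  rsum (fun i => a * f i + b * g i) n = a * rsum f n + b * rsum g n.
Proof. induction n as [|n IH]; simpl; [ring|rewrite IH; ring]. Qed.

(* [chain E w a b v]: some nondecreasing finite sequence runs from [a] to [b],
   consecutive terms are [E]-related, and the weights [w] of its steps add up
   to [v]. *)
Inductive chain (E : R -> R -> Prop) (w : R -> R -> R) : R -> R -> R -> Prop :=
| chain_one a : chain E w a a 0
| chain_snoc a b c v :
    chain E w a b v -> b <= c -> E b c -> chain E w a c (v + w b c).

Section Chains.
Variables (E : R -> R -> Prop) (w : R -> R -> R).

Lemma chain_le (a b v : R) : chain E w a b v -> a <= b.
Proof. induction 1; lra. Qed.

Lemma chain_cat (a b c u v : R) :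
  chain E w a b u -> chain E w b c v -> chain E w a c (u + v).
Proof.
  intros Hab Hbc; induction Hbc as [b|b c d v Hbc IH Hcd HE].
  - now rewrite Rplus_0_r.
  - rewrite <- Rplus_assoc; constructor; auto.
Qed.

Lemma chain_mono (E' : R -> R -> Prop) (w' : R -> R -> R) (a b v : R) :
  (forall x y, E x y -> E' x y) -> (forall x y, w x y <= w' x y) ->
  chain E w a b v -> exists v', chain E' w' a b v' /\ v <= v'.
Proof.
  intros HE Hw; induction 1 as [a|a b c v _ [v' [IH Hv]] Hbc HEbc].
  - exists 0; split; [constructor|lra].
  - exists (v' + w' b c); split; [constructor; auto|].
    specialize (Hw b c); lra.
Qed.

(** Cutting a chain at [t] loses only the step that straddles [t], whose weight is at most [k]. *)
Lemma chain_split (k t x y u : R) :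
  (forall a b, w a b <= k) -> chain E w x y u ->
  y <= t \/ t <= x \/
  exists x1 x2 u1 u2, chain E w x x1 u1 /\ chain E w x2 y u2 /\
    x1 <= t <= x2 /\ u <= u1 + u2 + k.
Proof.
  intros Hk; induction 1 as [x|x y z u Hxy IH Hyz HE]; [lra|].
  destruct (Rle_dec z t) as [Hzt|Hzt]; [now left|right].
  destruct IH as [Hyt|[Htx|(x1 & x2 & u1 & u2 & H1 & H2 & Ht & Hu)]].
  - right; exists y, z, u, 0; split; [assumption|].
    split; [constructor|]; split; [lra|]; specialize (Hk y z); lra.
  - now left.
  - right; exists x1, x2, u1, (u2 + w y z); split; [assumption|].
    split; [now constructor|]; split; [assumption|lra].
Qed.

Hypothesis w_ge0 : forall x y, 0 <= w x y.
Hypothesis w_refl : forall x, w x x = 0.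

(** Chains may repeat a point but partitions may not: a step with [b = c] has weight 0 and is
    dropped. *)
Lemma path_extend (t : nat -> R) (m : nat) (b c : R) :
  t 0%nat = 0 -> t m = b -> (forall i, (i < m)%nat -> t i < t (S i)) ->
  b <= c ->
  exists t' m', t' 0%nat = 0 /\ t' m' = c /\
    (forall i, (i < m')%nat -> t' i < t' (S i)) /\
    rsum (fun j => w (t' j) (t' (S j))) m' =
      rsum (fun j => w (t j) (t (S j))) m + w b c.
Proof.
  intros H0 Hm Hinc [Hbc|<-].
  - exists (fun i => if Nat.leb i m then t i else c), (S m).
    assert (Hl : forall i, (i <= m)%nat -> Nat.leb i m = true)
      by (intros; now apply Nat.leb_le).
    assert (Hg : Nat.leb (S m) m = false) by (apply Nat.leb_gt; lia).
    split; [assumption|]; split; [now rewrite Hg|]; split.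
    + intros i Hi; rewrite (Hl i) by lia.
      destruct (Nat.eq_dec i m) as [->|Hne]; [rewrite Hg, Hm; lra|].
      rewrite Hl by lia; apply Hinc; lia.
    + cbn [rsum]; rewrite (Hl m), Hg, Hm by lia; f_equal.
      apply rsum_eq; intros i Hi; now rewrite !Hl by lia.
  - exists t, m; rewrite w_refl, Rplus_0_r; auto.
Qed.

(** Joining 0 to [a] and [b] to 1 completes a chain to a partition, and the added weights are
    nonnegative. Thus a bound on all variation sums bounds all chains. *)
Lemma chain_partition (a b v : R) :
  chain E w a b v -> 0 <= a -> b <= 1 ->
  exists t m, partition01 t m /\
    v <= rsum (fun j => w (t j) (t (S j))) m.
Proof.
  intros Hch Ha Hb.
  assert (Hpath : exists t m, t 0%nat = 0 /\ t m = b /\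
    (forall i, (i < m)%nat -> t i < t (S i)) /\
    v <= rsum (fun j => w (t j) (t (S j))) m).
  { clear Hb; induction Hch as [a|a b c v Hab IH Hbc HE].
    - destruct (path_extend (fun _ => 0) 0 0 a) as (t & m & H0 & Hm & Hi & Hs);
        auto; [intros; lia|].
      exists t, m; repeat split; auto; rewrite Hs; simpl.
      specialize (w_ge0 0 a); lra.
    - destruct (IH Ha) as (t & m & H0 & Hm & Hi & Hs).
      destruct (path_extend t m b c) as (t' & m' & H0' & Hm' & Hi' & Hs'); auto.
      exists t', m'; repeat split; auto; rewrite Hs'; lra. }
  destruct Hpath as (t & m & H0 & Hm & Hi & Hs).
  destruct (path_extend t m b 1) as (t' & m' & H0' & Hm' & Hi' & Hs'); auto.
  exists t', m'; repeat split; auto.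
  rewrite Hs'; specialize (w_ge0 b 1); lra.
Qed.

End Chains.

(** * Chains close to the zeros of [r] have small weight *)

Section SmallChains.
Variables (p : R) (D : R -> R -> R) (r : R -> R).
Hypothesis p_gt0 : 0 < p.
Hypothesis D_ge0 : forall x y, 0 <= D x y.
Hypothesis D_triangle : forall x y z, D x z <= D x y + D y z.
Hypothesis D_le : forall x y, D x y <= r x + r y.

Definition near_zero (d x y : R) : Prop := r x <= d \/ r y <= d.

(** Two points with [r <= d] are at distance at most [2 * d], so the truncation does not affect
    steps between them. It makes the loss of any single step negligible as [d] tends to 0. *)
Definition trunc_weight (d x y : R) : R := powp (Rmin (D x y) (2 * d)) p.

Notation zchain d := (chain (near_zero d) (trunc_weight d)).

Lemma trunc_weight_le (d x y : R) :
  trunc_weight d x y <= powp (2 * d) p.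
Proof. apply powp_le; auto; apply Rmin_r. Qed.

Lemma trunc_weight_ge0 (d x y : R) : 0 <= trunc_weight d x y.
Proof. now apply powp_ge0. Qed.

Lemma zchain_mono (d d' a b v : R) :
  d <= d' -> zchain d a b v -> exists v', zchain d' a b v' /\ v <= v'.
Proof.
  intros Hd; apply chain_mono.
  - intros x y [H|H]; [left|right]; lra.
  - intros x y; apply powp_le; auto; apply Rle_min_compat_l; lra.
Qed.

(** If [r] exceeds [d] at the first point, it cannot do so at the second, so dropping one step is
    enough. *)
Lemma zchain_trim_front (d x y u : R) :
  zchain d x y u ->
  (u = 0 /\ ~ r y <= d) \/
  exists x' u', r x' <= d /\ x <= x' /\ zchain d x' y u' /\
    u <= u' + powp (2 * d) p.
Proof.
  pose proof (powp_ge0 p (2 * d)) as Hk.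
  induction 1 as [x|x y z u Hxy IH Hyz HE].
  - destruct (Rle_dec (r x) d) as [Hr|Hr]; [right|now left].
    exists x, 0; repeat split; try lra; constructor.
  - right; destruct IH as [[-> Hy]|(x' & u' & Hx' & Hxx' & Hc & Hu)].
    + exists z, 0; pose proof (trunc_weight_le d y z).
      apply chain_le in Hxy.
      repeat split; [|lra|constructor|lra].
      destruct HE; [contradiction|assumption].
    + exists x', (u' + trunc_weight d y z).
      repeat split; try lra; now constructor.
Qed.

(** Once both ends have [r <= d], any point may be linked to either of them by a [near_zero] step;
    this is what allows chains to be glued. *)
Lemma zchain_trim (d x y u : R) :
  zchain d x y u ->
  u <= 2 * powp (2 * d) p \/
  exists x' y' u', r x' <= d /\ r y' <= d /\ x <= x' /\ y' <= y /\
    zchain d x' y' u' /\ u <= u' + 2 * powp (2 * d) p.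
Proof.
  pose proof (powp_ge0 p (2 * d)) as Hk.
  intros Hc; destruct (zchain_trim_front _ _ _ _ Hc)
    as [[-> _]|(x' & u' & Hx' & Hxx' & Hc' & Hu)]; [left; lra|right].
  destruct (Rle_dec (r y) d) as [Hy|Hy].
  - exists x', y, u'; repeat split; auto; lra.
  - destruct Hc' as [x'|x' y' y u' Hc' Hyy HE]; [contradiction|].
    pose proof (trunc_weight_le d y' y).
    exists x', y', u'; repeat split; auto; try lra.
    destruct HE; [assumption|contradiction].
Qed.

Lemma zchain_append (d1 d2 a b q x y u : R) :
  d2 <= d1 -> zchain d1 a b q -> zchain d2 x y u -> b <= x ->
  exists e q', (e = b \/ e <= y) /\ zchain d1 a e q' /\
    q + u - 2 * powp (2 * d2) p <= q'.
Proof.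
  intros Hd Hq Hu Hbx.
  destruct (zchain_trim _ _ _ _ Hu)
    as [Hs|(x' & y' & u' & Hx' & Hy' & Hxx' & Hyy' & Hc & Hu')].
  - exists b, q; repeat split; auto; lra.
  - destruct (zchain_mono _ d1 _ _ _ Hd Hc) as (u1 & Hc1 & Hu1).
    exists y', (q + trunc_weight d1 b x' + u1).
    pose proof (trunc_weight_ge0 d1 b x').
    repeat split; auto; [|lra].
    apply chain_cat with x'; [|assumption].
    constructor; auto; [lra|right; lra].
Qed.

(* Detouring from [b] to [c] through points where [r] is at most [d2] costs at
   most a constant factor on the step [b, c], since the detour returns to
   within [2 * d2] of where it started. *)
Lemma zchain_detour (d1 d2 a b c q x y u : R) :
  0 < d2 <= d1 -> zchain d1 a b q -> b <= c -> near_zero d1 b c ->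
  zchain d2 x y u -> b <= x -> y <= c ->
  exists q', zchain d1 a c q' /\
    q + / powp 3 p * trunc_weight d1 b c + u - 3 * powp (2 * d2) p <= q'.
Proof.
  intros Hd Hq Hbc HE Hu Hbx Hyc.
  pose proof (powp_3_inv p p_gt0) as H3i.
  pose proof (powp_pos p 3 ltac:(lra)) as H3.
  pose proof (powp_ge0 p (2 * d2)) as Hk.
  pose proof (trunc_weight_ge0 d1 b c) as Hw.
  destruct (zchain_trim _ _ _ _ Hu)
    as [Hs|(x' & y' & u' & Hx' & Hy' & Hxx' & Hyy' & Hc & Hu')].
  - exists (q + trunc_weight d1 b c); split; [now constructor|]; nra.
  - destruct (zchain_mono _ d1 _ _ _ (proj2 Hd) Hc) as (u1 & Hc1 & Hu1).
    exists (q + trunc_weight d1 b x' + u1 + trunc_weight d1 y' c).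
    pose proof (chain_le _ _ _ _ _ Hc).
    split.
    + constructor; [|lra|left; lra].
      apply chain_cat with x'; [|assumption].
      constructor; auto; [lra|right; lra].
    (* Here [D x' y' <= r x' + r y' <= 2 * d2]. This middle term and the two trimmed ends make up
       the error of three [powp (2 * d2) p]. *)
    + assert (Htri : trunc_weight d1 b c <= powp 3 p *
        (trunc_weight d1 b x' + powp (2 * d2) p + trunc_weight d1 y' c)).
      { apply powp_add3_le; auto; try lra;
          try (apply Rmin_glb; [apply D_ge0|lra]).
        pose proof (D_triangle b x' c); pose proof (D_triangle x' y' c).
        pose proof (D_le x' y').
        pose proof (D_ge0 b x'); pose proof (D_ge0 y' c).
        unfold Rmin; destruct (Rle_dec (D b c) (2 * d1));
          destruct (Rle_dec (D b x') (2 * d1));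
          destruct (Rle_dec (D y' c) (2 * d1)); lra. }
      apply (Rmult_le_compat_l (/ powp 3 p)) in Htri; [|lra].
      rewrite <- Rmult_assoc, Rinv_l, Rmult_1_l in Htri; lra.
Qed.

(** By induction on the coarse chain, the fine chain is cut at each coarse point and every piece
    becomes a detour in the coarse step containing it. The number of cuts depends on the coarse
    chain alone, so [N] is fixed before [d2]. The clause on [a'] keeps the result inside
    [[0, 1]]. *)
Lemma zchain_merge_below (d1 a b v : R) :
  0 < d1 -> zchain d1 a b v -> exists N, 0 <= N /\
    forall d2 x y u, 0 < d2 <= d1 -> zchain d2 x y u -> y <= b ->
    exists a' q, (a' = a \/ x <= a') /\ zchain d1 a' b q /\
      / powp 3 p * v + u - N * powp (2 * d2) p <= q.
Proof.
  intros Hd1; induction 1 as [a|a b c v Hab IH Hbc HE].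
  - exists 2; split; [lra|]; intros d2 x y u Hd Hu Hya.
    destruct (zchain_trim _ _ _ _ Hu)
      as [Hs|(x' & y' & u' & Hx' & Hy' & Hxx' & Hyy' & Hc & Hu')].
    + exists a, 0; split; [auto|]; split; [constructor|lra].
    + destruct (zchain_mono _ d1 _ _ _ (proj2 Hd) Hc) as (u1 & Hc1 & Hu1).
      exists x', (u1 + trunc_weight d1 y' a); split; [auto|]; split.
      * constructor; [assumption|lra|left; lra].
      * pose proof (trunc_weight_ge0 d1 y' a); lra.
  - destruct IH as (N & HN & IH).
    (* Three error terms come from the detour and one from the cut at [b]. *)
    exists (N + 4); split; [lra|]; intros d2 x y u Hd Hu Hyc.
    pose proof (powp_ge0 p (2 * d2)) as Hk.
    pose proof (powp_3_inv p p_gt0) as H3i.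
    assert (Hv : 0 <= v).
    { clear - Hab p_gt0; induction Hab; [lra|].
      pose proof (trunc_weight_ge0 d1 b c); lra. }
    pose proof (trunc_weight_ge0 d1 b c) as Hw.
    destruct (chain_split _ _ _ b _ _ _ (trunc_weight_le d2) Hu)
      as [Hyb|[Hbx|(x1 & x2 & u1 & u2 & H1 & H2 & Hb & Hu')]].
    + destruct (IH d2 x y u Hd Hu Hyb) as (a' & q & Ha' & Hq & Hle).
      exists a', (q + trunc_weight d1 b c); split; [auto|].
      split; [now constructor|]; nra.
    + destruct (zchain_detour d1 d2 a b c v x y u) as (q & Hq & Hle); auto.
      exists a, q; split; [auto|]; split; [assumption|]; nra.
    + destruct (IH d2 x x1 u1 Hd H1 (proj1 Hb)) as (a' & q & Ha' & Hq & Hle).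
      destruct (zchain_detour d1 d2 a' b c q x2 y u2) as (q' & Hq' & Hle'); auto;
        [lra|].
      exists a', q'; split; [auto|]; split; [assumption|]; lra.
Qed.

Lemma zchain_merge (d1 a b v : R) :
  0 < d1 -> 0 <= a -> b <= 1 -> zchain d1 a b v -> exists N, 0 <= N /\
    forall d2 x y u, 0 < d2 <= d1 -> 0 <= x -> y <= 1 -> zchain d2 x y u ->
    exists a' b' q, 0 <= a' /\ b' <= 1 /\ zchain d1 a' b' q /\
      / powp 3 p * v + u - N * powp (2 * d2) p <= q.
Proof.
  intros Hd1 Ha Hb Hv.
  destruct (zchain_merge_below _ _ _ _ Hd1 Hv) as (N & HN & Hmerge).
  (* Beyond [b] the fine chain is appended: one error term for the cut, two for trimming. *)
  exists (N + 3); split; [lra|]; intros d2 x y u Hd Hx Hy Hu.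
  pose proof (powp_ge0 p (2 * d2)) as Hk.
  destruct (chain_split _ _ _ b _ _ _ (trunc_weight_le d2) Hu)
    as [Hyb|[Hbx|(x1 & x2 & u1 & u2 & H1 & H2 & Hb' & Hu')]].
  - destruct (Hmerge d2 x y u Hd Hu Hyb) as (a' & q & Ha' & Hq & Hle).
    exists a', b, q; repeat split; auto; [destruct Ha'; lra|lra].
  (* The fine chain lies entirely to the right of [b], so a one-point chain at [a] is merged in its
     place below [b]. *)
  - destruct (Hmerge d2 a a 0 Hd) as (a' & q & Ha' & Hq & Hle);
      [constructor|now apply chain_le in Hv|].
    destruct (zchain_append d1 d2 a' b q x y u) as (e & q' & He & Hq' & Hle');
      auto; [lra|].
    exists a', e, q'; repeat split; auto;
      [destruct Ha'; lra|destruct He; lra|lra].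
  - destruct (Hmerge d2 x x1 u1 Hd H1 (proj1 Hb')) as (a' & q & Ha' & Hq & Hle).
    destruct (zchain_append d1 d2 a' b q x2 y u2) as (e & q' & He & Hq' & Hle');
      auto; [lra|lra|].
    exists a', e, q'; repeat split; auto;
      [destruct Ha'; lra|destruct He; lra|lra].
Qed.

Variable M : R.
Hypothesis D_bounded : forall E a b v, 0 <= a -> b <= 1 ->
  chain E (fun x y => powp (D x y) p) a b v -> v <= M.

Lemma small_chains (eta d0 : R) : 0 < eta -> 0 < d0 ->
  exists d, 0 < d <= d0 /\
    forall a b v, 0 <= a -> b <= 1 -> zchain d a b v -> v <= eta.
Proof.
  intros Heta Hd0; apply NNPP; intros Hno.
  assert (Hbig : forall d, 0 < d <= d0 -> exists a b v,
    0 <= a /\ b <= 1 /\ zchain d a b v /\ eta < v).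
  { intros d Hd; apply NNPP; intros Hn; apply Hno.
    exists d; split; [assumption|]; intros a b v Ha Hb Hc.
    destruct (Rle_dec v eta); [assumption|].
    exfalso; apply Hn; exists a, b, v; repeat split; auto; lra. }
  (* Each merge gains at least [2 * eta'] and loses at most [eta'] to the error terms. *)
  set (eta' := / powp 3 p * eta / 2).
  assert (Heta' : 0 < eta').
  { unfold eta'; pose proof (powp_pos p 3 ltac:(lra)) as H3.
    apply Rinv_0_lt_compat in H3; nra. }
  (* The claim covers every scale, so that the induction hypothesis applies at a [d2] chosen after
     the coarse chain and its [N]. *)
  assert (Hgrow : forall k d, 0 < d <= d0 -> exists a b v,
    0 <= a /\ b <= 1 /\ zchain d a b v /\ INR k * eta' <= v).
  { induction k as [|k IH]; intros d Hd.
    - exists 0, 0, 0; repeat split; try lra; [constructor|simpl; lra].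
    - destruct (Hbig d Hd) as (a & b & v & Ha & Hb & Hv & Hlt).
      destruct (zchain_merge d a b v) as (N & HN & Hmerge); auto; [lra|].
      destruct (powp_small p p_gt0 (N * powp 2 p) eta' d) as (d2 & Hd2 & Hs);
        auto; [|lra|].
      { apply Rmult_le_pos; auto; apply powp_ge0; auto. }
      destruct (IH d2) as (x & y & u & Hx & Hy & Hu & Hle); [lra|].
      destruct (Hmerge d2 x y u) as (a' & b' & q & Ha' & Hb' & Hq & Hle'); auto.
      exists a', b', q; repeat split; auto.
      rewrite powp_mul in Hle' by lra.
      rewrite S_INR.
      assert (2 * eta' <= / powp 3 p * v).
      { unfold eta'; pose proof (powp_pos p 3 ltac:(lra)) as H3.
        apply Rinv_0_lt_compat in H3; nra. }
      lra. }
  destruct (INR_unbounded (M / eta')) as (k & Hk).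
  destruct (Hgrow k d0) as (a & b & v & Ha & Hb & Hv & Hle); [lra|].
  assert (Hmono : exists v',
    chain (near_zero d0) (fun x y => powp (D x y) p) a b v' /\ v <= v').
  { apply chain_mono with (3 := Hv); auto.
    intros x y; apply powp_le; auto; apply Rmin_l. }
  destruct Hmono as (v' & Hv' & Hvv').
  pose proof (D_bounded _ _ _ _ Ha Hb Hv').
  apply (Rmult_lt_compat_r eta') in Hk; [|assumption].
  unfold Rdiv in Hk; rewrite Rmult_assoc, Rinv_l, Rmult_1_r in Hk; lra.
Qed.

End SmallChains.

(** * The bad set: switches and variation along a partition *)

Section Hysteresis.
Variables (p : R) (D : R -> R -> R) (r : R -> R) (d eta : R).
Hypothesis p_gt0 : 0 < p.
Hypothesis d_gt0 : 0 < d.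
Hypothesis D_le : forall x y, D x y <= r x + r y.
Hypothesis r_lip : forall x y, Rabs (r x - r y) <= D x y.
Hypothesis eta_ge0 : 0 <= eta.
Hypothesis zchain_le : forall a b v, 0 <= a -> b <= 1 ->
  chain (near_zero r d) (trunc_weight p D d) a b v -> v <= eta.

(* A hysteresis rule: scanning from the left, one becomes bad when [r] drops
   below [d / 2] and recovers only when [r] reaches [d]. *)
Definition bad (x : R) : Prop :=
  exists y, 0 <= y <= x /\ r y < d / 2 /\ forall z, y <= z <= x -> r z < d.

Lemma bad_lt (x : R) : bad x -> r x < d.
Proof. intros (y & Hy & _ & H); apply H; lra. Qed.

Lemma not_bad_ge (x : R) : 0 <= x -> ~ bad x -> d / 2 <= r x.
Proof.
  intros Hx Hb; apply Rnot_lt_le; intros H; apply Hb.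
  exists x; repeat split; try lra.
  intros z Hz; replace z with x by lra; lra.
Qed.

Lemma bad_exit (x y : R) : x < y -> bad x -> ~ bad y ->
  exists z, x <= z <= y /\ d <= r z.
Proof.
  intros Hxy (u & Hu & Hru & Hz) Hy; apply NNPP; intros Hno; apply Hy.
  exists u; repeat split; try lra; intros z Hz'.
  destruct (Rle_dec z x); [apply Hz; lra|].
  apply Rnot_le_lt; intros H; apply Hno; exists z; lra.
Qed.

(** The drop that makes [y] bad must occur after [x]; otherwise the same drop would make [x] bad. *)
Lemma bad_entry (x y : R) : 0 <= x -> x < y -> ~ bad x -> bad y ->
  exists z, x <= z <= y /\ r z < d / 2.
Proof.
  intros Hx Hxy Hb (u & Hu & Hru & Hz).
  destruct (Rle_dec x u); [exists u; lra|].
  exfalso; apply Hb; exists u; repeat split; try lra.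
  intros z Hz'; apply Hz; lra.
Qed.

Definition badb (x : R) : bool :=
  if excluded_middle_informative (bad x) then true else false.

Lemma badP (x : R) : reflect (bad x) (badb x).
Proof.
  unfold badb; destruct (excluded_middle_informative (bad x)); now constructor.
Qed.

Section Partition.
Variables (t : nat -> R) (m : nat).
Hypothesis t_part : partition01 t m.

Lemma partition_ge0 (k : nat) : (k <= m)%nat -> 0 <= t k.
Proof.
  destruct t_part as (H0 & _ & Hi); induction k as [|k IH]; intros Hk; [lra|].
  specialize (IH ltac:(lia)); specialize (Hi k ltac:(lia)); lra.
Qed.

Lemma partition_le1 (k : nat) : (k <= m)%nat -> t k <= 1.
Proof.
  destruct t_part as (_ & H1 & Hi); intros Hk.
  replace k with (m - (m - k))%nat by lia.
  generalize (m - k)%nat (Nat.le_sub_l m k); clear k Hk.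
  intros j; induction j as [|j IH]; intros Hj.
  - rewrite Nat.sub_0_r; lra.
  - specialize (IH ltac:(lia)); specialize (Hi (m - S j)%nat ltac:(lia)).
    replace (S (m - S j))%nat with (m - j)%nat in Hi by lia; lra.
Qed.

Definition both_bad_weight (j : nat) : R :=
  if andb (badb (t j)) (badb (t (S j))) then powp (D (t j) (t (S j))) p else 0.

Definition switches (j : nat) : R :=
  if xorb (badb (t j)) (badb (t (S j))) then 1 else 0.

(** At bad points [r < d], so successive bad points of the partition form one chain even across
    gaps. On a step between two of them [D <= 2 * d], and the truncated weight is the full power. *)
Lemma both_bad_sum_le : rsum both_bad_weight m <= eta.
Proof.
  (* The chain ends at the last bad point met; the first alternative is the stretch before any bad
     point. *)
  assert (H : forall k, (k <= m)%nat ->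
    (rsum both_bad_weight k = 0 /\ ~ bad (t k)) \/
    exists a b v, 0 <= a /\ b <= t k /\ bad b /\ (bad (t k) -> b = t k) /\
      chain (near_zero r d) (trunc_weight p D d) a b v /\
      rsum both_bad_weight k <= v).
  { induction k as [|k IH]; intros Hk.
    - destruct (classic (bad (t 0%nat))) as [Hb|Hb]; [right|left; auto].
      exists (t 0%nat), (t 0%nat), 0; pose proof (partition_ge0 0 Hk).
      repeat split; auto; simpl; try lra; constructor.
    - specialize (IH ltac:(lia)).
      assert (Hlt : t k < t (S k)) by (apply t_part; lia).
      pose proof (partition_ge0 (S k) Hk) as Hge.
      cbn [rsum]; unfold both_bad_weight at 2 4.
      destruct (badP (t k)) as [Hbk|Hbk]; destruct (badP (t (S k))) as [Hb|Hb];
        cbn [andb].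
      + destruct IH as [[_ []]|(a & b & v & Ha & Hbt & Hbb & Heq & Hc & Hv)];
          [assumption|right].
        specialize (Heq Hbk); subst b.
        exists a, (t (S k)), (v + trunc_weight p D d (t k) (t (S k))).
        apply bad_lt in Hbk; pose proof (bad_lt _ Hb).
        repeat split; auto; try lra.
        * constructor; [assumption|lra|left; lra].
        * unfold trunc_weight; rewrite Rmin_left; [lra|].
          pose proof (D_le (t k) (t (S k))); lra.
      + destruct IH as [[_ []]|(a & b & v & Ha & Hbt & Hbb & Heq & Hc & Hv)];
          [assumption|right].
        exists a, b, v; repeat split; auto; try lra; intros; contradiction.
      + right.
        destruct IH as [[H0 _]|(a & b & v & Ha & Hbt & Hbb & Heq & Hc & Hv)].
        * exists (t (S k)), (t (S k)), 0; repeat split; auto; try lra; constructor.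
        * exists a, (t (S k)), (v + trunc_weight p D d b (t (S k))).
          pose proof (trunc_weight_ge0 p D d b (t (S k))).
          apply bad_lt in Hbb.
          repeat split; auto; try lra; constructor; [assumption|lra|left; lra].
      + destruct IH as [[H0 _]|(a & b & v & Ha & Hbt & Hbb & Heq & Hc & Hv)];
          [left; split; auto; lra|right].
        exists a, b, v; repeat split; auto; try lra; intros; contradiction. }
  destruct (H m (le_n m)) as [[-> _]|(a & b & v & Ha & Hb & _ & _ & Hc & Hv)];
    [assumption|].
  pose proof (partition_le1 m (le_n m)).
  apply zchain_le in Hc; lra.
Qed.

(* Between two switches [r] crosses the gap from [d / 2] to [d]. *)
Lemma switches_le : rsum switches m * powp (d / 2) p <= eta + powp (d / 2) p.
Proof.
  pose proof (powp_ge0 p (d / 2)) as Hq.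
  assert (Hgap : forall x y, Rabs (r x - r y) >= d / 2 ->
    powp (d / 2) p <= trunc_weight p D d x y).
  { intros x y Hxy; apply powp_le; auto; apply Rmin_glb; [|lra].
    pose proof (r_lip x y); lra. }
  (* The chain runs through the crossing points, and [b] is the latest one, low or high according to
     the current state. The first switch only starts the chain, whence the [- 1]. *)
  assert (H : forall k, (k <= m)%nat ->
    rsum switches k = 0 \/
    exists a b v, 0 <= a /\ b <= t k /\
      (bad (t k) -> r b < d / 2) /\ (~ bad (t k) -> d <= r b) /\
      chain (near_zero r d) (trunc_weight p D d) a b v /\
      (rsum switches k - 1) * powp (d / 2) p <= v).
  { induction k as [|k IH]; intros Hk; [now left|].
    specialize (IH ltac:(lia)).
    assert (Hlt : t k < t (S k)) by (apply t_part; lia).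
    pose proof (partition_ge0 k ltac:(lia)) as Hge.
    cbn [rsum]; unfold switches at 2 4.
    destruct (badP (t k)) as [Hbk|Hbk]; destruct (badP (t (S k))) as [Hb|Hb];
      cbn [xorb].
    1, 4: destruct IH as [H0|(a & b & v & Ha & Hbt & Hb1 & Hb2 & Hc & Hv)];
      [left; lra|right; exists a, b, v; rewrite Rplus_0_r; repeat split; auto;
        try lra; intros; now (contradiction || auto)].
    - destruct (bad_exit _ _ Hlt Hbk Hb) as (z & Hz & Hrz); right.
      destruct IH as [H0|(a & b & v & Ha & Hbt & Hb1 & Hb2 & Hc & Hv)].
      + exists z, z, 0; rewrite H0; repeat split; try lra;
          [intros; contradiction|constructor].
      + specialize (Hb1 Hbk).
        exists a, z, (v + trunc_weight p D d b z).
        repeat split; auto; try lra; [intros; contradiction| |].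
        * constructor; [assumption|lra|left; lra].
        * assert (powp (d / 2) p <= trunc_weight p D d b z); [|lra].
          apply Hgap; rewrite Rabs_left; lra.
    - destruct (bad_entry _ _ Hge Hlt Hbk Hb) as (z & Hz & Hrz); right.
      destruct IH as [H0|(a & b & v & Ha & Hbt & Hb1 & Hb2 & Hc & Hv)].
      + exists z, z, 0; rewrite H0; repeat split; try lra;
          [intros; contradiction|constructor].
      + specialize (Hb2 Hbk).
        exists a, z, (v + trunc_weight p D d b z).
        repeat split; auto; try lra; [intros; contradiction| |].
        * constructor; [assumption|lra|right; lra].
        * assert (powp (d / 2) p <= trunc_weight p D d b z); [|lra].
          apply Hgap; rewrite Rabs_right; lra. }
  destruct (H m (le_n m)) as [->|(a & b & v & Ha & Hb & _ & _ & Hc & Hv)]; [lra|].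
  pose proof (partition_le1 m (le_n m)).
  apply zchain_le in Hc; lra.
Qed.

(** One [eta] pays for the steps between bad points, the other for all switches but the first, and
    [powp (d / 2) p] for the first. *)
Lemma bad_variation (W : R -> R -> R) (k : R) :
  0 <= k ->
  (forall x y, bad x -> bad y -> W x y <= k * powp (D x y) p) ->
  (forall x y, ~ bad x -> ~ bad y -> W x y <= 0) ->
  (forall x y, bad x -> ~ bad y -> W x y <= k * powp (d / 2) p) ->
  (forall x y, ~ bad x -> bad y -> W x y <= k * powp (d / 2) p) ->
  rsum (fun j => W (t j) (t (S j))) m <= k * (2 * eta + powp (d / 2) p).
Proof.
  intros Hk Hbb Hgg Hbg Hgb.
  apply Rle_trans with
    (rsum (fun j => k * both_bad_weight j + k * powp (d / 2) p * switches j) m).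
  - apply rsum_le; intros i _; unfold both_bad_weight, switches.
    destruct (badP (t i)) as [H|H]; destruct (badP (t (S i))) as [H'|H'];
      cbn [andb xorb].
    + specialize (Hbb _ _ H H'); lra.
    + specialize (Hbg _ _ H H'); lra.
    + specialize (Hgb _ _ H H'); lra.
    + specialize (Hgg _ _ H H'); lra.
  - rewrite rsum_lin; pose proof both_bad_sum_le; pose proof switches_le; nra.
Qed.

End Partition.
End Hysteresis.

(** * Suprema, and a common interface for the real and complex scalars *)

Lemma sup_R_le (A : R -> Prop) (y B : R) :
  A y -> (forall x, A x -> x <= B) -> sup_R A <= B.
Proof.
  intros Hy HB; unfold sup_R.
  destruct (excluded_middle_informative (exists l, is_lub A l)) as [H|H].
  - destruct (constructive_indefinite_description _ H) as [l Hl]; simpl.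
    now apply Hl.
  (* A nonempty set bounded above has a least upper bound, so the default value 0 does not arise. *)
  - exfalso; apply H.
    destruct (completeness A) as [l Hl]; [now exists B|now exists y|].
    now exists l.
Qed.

(** All estimates are phrased through [sub], [mul] and [nm], the only operations the theorem
    provides. In [scalar_div], [c] stands for the real [d] as a scalar and [q] for division by
    it. *)
Record scalar_field (K : Type) (sub mul : K -> K -> K) (nm : K -> R) : Prop := {
  nm_ge0 : forall x, 0 <= nm x;
  nm_sub_diag : forall x, nm (sub x x) = 0;
  nm_sub_sym : forall x y, nm (sub x y) = nm (sub y x);
  nm_sub_le : forall x y, nm (sub x y) <= nm x + nm y;
  nm_le_sub : forall x y, nm x <= nm y + nm (sub x y);
  nm_sub_triangle : forall x y z, nm (sub x z) <= nm (sub x y) + nm (sub y z);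
  nm_sub4_le : forall a b c e,
    nm (sub (sub a b) (sub c e)) <= nm (sub a c) + nm (sub b e);
  nm_sub4_ge : forall a b c e,
    nm (sub b e) <= nm (sub a c) + nm (sub (sub a b) (sub c e));
  nm_mul : forall x y, nm (mul x y) = nm x * nm y;
  nm_mul_sub : forall x y x' y', nm (sub (mul x y) (mul x' y')) <=
    nm x * nm (sub y y') + nm y' * nm (sub x x');
  scalar_div : forall d, 0 < d -> exists (c : K) (q : K -> K),
    nm c = d /\ (forall z, mul c (q z) = z) /\
    (forall z, nm (q z) = nm z / d) /\
    (forall z z', nm (sub (q z) (q z')) = nm (sub z z') / d)
}.

Lemma scalar_field_R : scalar_field R Rminus Rmult Rabs.
Proof.
  split.
  - exact Rabs_pos.
  - intros x; rewrite Rminus_diag; apply Rabs_R0.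
  - exact Rabs_minus_sym.
  - intros x y; pose proof (Rabs_triang x (- y)) as H.
    rewrite Rabs_Ropp in H; exact H.
  - intros x y; pose proof (Rabs_triang y (x - y)) as H.
    now replace (y + (x - y)) with x in H by ring.
  - intros x y z; pose proof (Rabs_triang (x - y) (y - z)) as H.
    now replace (x - y + (y - z)) with (x - z) in H by ring.
  - intros a b c e; pose proof (Rabs_triang (a - c) (- (b - e))) as H.
    rewrite Rabs_Ropp in H.
    now replace (a - c + - (b - e)) with (a - b - (c - e)) in H by ring.
  - intros a b c e; pose proof (Rabs_triang (a - c) (- (a - b - (c - e)))) as H.
    rewrite Rabs_Ropp in H.
    now replace (a - c + - (a - b - (c - e))) with (b - e) in H by ring.
  - exact Rabs_mult.
  - intros x y x' y'; rewrite <- !Rabs_mult.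
    pose proof (Rabs_triang (x * (y - y')) (y' * (x - x'))) as H.
    now replace (x * (y - y') + y' * (x - x')) with (x * y - x' * y') in H by ring.
  - intros d Hd; exists d, (fun z => z / d).
    assert (Hdiv : forall z, Rabs (z / d) = Rabs z / d).
    { intros z; unfold Rdiv; rewrite Rabs_mult, (Rabs_right (/ d)); [reflexivity|].
      apply Rinv_0_lt_compat in Hd; lra. }
    repeat split; auto.
    + apply Rabs_right; lra.
    + intros z; field; lra.
    + intros z z'; rewrite <- Hdiv; f_equal; field; lra.
Qed.

(** Stated with an equation on components, so that each use reduces to [ring] identities. *)
Lemma Cnorm_sum (z u v : Cpx) :
  z = (fst u + fst v, snd u + snd v) -> Cnorm z <= Cnorm u + Cnorm v.
Proof. intros ->; apply (Complex.Cmod_triangle u v). Qed.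

Lemma Cnorm_diff (z u v : Cpx) :
  z = (fst u - fst v, snd u - snd v) -> Cnorm z <= Cnorm u + Cnorm v.
Proof.
  intros ->; rewrite <- (Complex.Cmod_opp v : Cnorm _ = Cnorm v).
  now apply Cnorm_sum.
Qed.

Lemma Cnorm_mul (z w : Cpx) : Cnorm (Cmul z w) = Cnorm z * Cnorm w.
Proof. apply (Complex.Cmod_mult z w). Qed.

Lemma scalar_field_C : scalar_field Cpx Csub Cmul Cnorm.
Proof.
  split.
  - exact Complex.Cmod_ge_0.
  - intros x; unfold Csub; rewrite !Rminus_diag; exact Complex.Cmod_0.
  - intros x y; unfold Cnorm, Csub; simpl; f_equal; ring.
  - intros x y; now apply Cnorm_diff.
  - intros [a b] [c e]; apply Cnorm_sum; unfold Csub; simpl; f_equal; ring.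
  - intros x y z; apply Cnorm_sum; unfold Csub; simpl; f_equal; ring.
  - intros a b c e; apply Cnorm_diff; unfold Csub; simpl; f_equal; ring.
  - intros a b c e; apply Cnorm_diff; unfold Csub; simpl; f_equal; ring.
  - exact Cnorm_mul.
  - intros x y x' y'; rewrite <- !Cnorm_mul; apply Cnorm_sum.
    unfold Csub, Cmul; simpl; f_equal; ring.
  - intros d Hd; exists (d, 0), (fun z => Cmul (/ d, 0) z).
    assert (Hreal : forall x, 0 < x -> Cnorm (x, 0) = x).
    { intros x Hx; etransitivity; [apply (Complex.Cmod_R x)|].
      apply Rabs_right; lra. }
    assert (Hdiv : forall z, Cnorm (Cmul (/ d, 0) z) = Cnorm z / d).
    { intros z; rewrite Cnorm_mul, Hreal by (now apply Rinv_0_lt_compat).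
      unfold Rdiv; ring. }
    repeat split; auto.
    + intros [a b]; unfold Cmul; simpl; f_equal; field; lra.
    + intros z z'; rewrite <- Hdiv; f_equal; unfold Csub, Cmul; simpl.
      f_equal; ring.
Qed.

(** * Variation and norm of scalar functions *)

Section Scalar.
Variables (K : Type) (sub mul : K -> K -> K) (nm : K -> R).
Hypothesis HK : scalar_field K sub mul nm.
Variable p : R.
Hypothesis p_gt0 : 0 < p.

Definition step_weight (f : R -> K) (x y : R) : R := powp (nm (sub (f y) (f x))) p.

(** [psum] always has at least one term, so it differs from [rsum] at [m = 0]; a partition from 0 to
    1 excludes that case. *)
Lemma var_sumsP (f : R -> K) (v : R) :
  var_sums K sub nm p f v <-> exists t m, partition01 t m /\
    v = rsum (fun j => step_weight f (t j) (t (S j))) m.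
Proof.
  split; intros (t & m & Ht & Hv); exists t, m; split; auto;
    rewrite Hv; unfold psum; rewrite sum_f_R0_rsum;
    destruct m; auto; destruct Ht; lra.
Qed.

Lemma BVp_norm_lt (f : R -> K) (eps : R) :
  0 < eps -> (forall x, 0 <= x <= 1 -> nm (f x) <= eps / 3) ->
  (forall v, var_sums K sub nm p f v -> v <= powp (eps / 3) p) ->
  BVp_norm K sub nm p f < eps.
Proof.
  intros Heps Hsup Hvar; unfold BVp_norm.
  assert (H1 : sup_R (abs_vals K nm f) <= eps / 3).
  { apply sup_R_le with (nm (f 0)); [exists 0; split; [lra|reflexivity]|].
    intros y (x & Hx & ->); auto. }
  assert (H2 : Var_p K sub nm p f <= powp (eps / 3) p).
  { apply sup_R_le with (psum K sub nm p f INR 1); [|assumption].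
    exists INR, 1%nat; split; [|reflexivity].
    repeat split; auto; intros i Hi; apply lt_INR; lia. }
  assert (Hip : 0 < 1 / p) by (apply Rdiv_lt_0_compat; lra).
  apply (powp_le (1 / p) Hip) in H2; rewrite powp_root in H2; lra.
Qed.

(** Serves to get [F1] and [G1] into [BVp] from the estimates on [F - F1] and [G - G1]. *)
Lemma BVp_of_diff (f g : R -> K) :
  BVp K sub nm p f -> BVp K sub nm p (fun x => sub (f x) (g x)) ->
  BVp K sub nm p g.
Proof.
  intros (M1 & H1) (M2 & H2); exists (powp 3 p * M1 + powp 3 p * M2).
  intros v Hv; apply var_sumsP in Hv; destruct Hv as (t & m & Ht & ->).
  apply Rle_trans with (powp 3 p * rsum (fun j => step_weight f (t j) (t (S j))) m
    + powp 3 p *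
      rsum (fun j => step_weight (fun x => sub (f x) (g x)) (t j) (t (S j))) m).
  - rewrite <- rsum_lin; apply rsum_le; intros i _.
    rewrite <- Rmult_plus_distr_l; apply powp_add_le; auto;
      try apply (nm_ge0 _ _ _ _ HK).
    apply (nm_sub4_ge _ _ _ _ HK).
  - pose proof (powp_ge0 p 3).
    apply Rplus_le_compat; apply Rmult_le_compat_l; auto;
      [apply H1|apply H2]; apply var_sumsP; now exists t, m.
Qed.

(** * The pair [(F, G)] and its modification on the bad set *)

Section Pair.
Variables F G : R -> K.

Definition pair_dist (x y : R) : R := nm (sub (F y) (F x)) + nm (sub (G y) (G x)).
Definition pair_norm (x : R) : R := nm (F x) + nm (G x).

Lemma pair_dist_ge0 (x y : R) : 0 <= pair_dist x y.
Proof.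
  unfold pair_dist; pose proof (nm_ge0 _ _ _ _ HK (sub (F y) (F x))).
  pose proof (nm_ge0 _ _ _ _ HK (sub (G y) (G x))); lra.
Qed.

Lemma pair_dist_triangle (x y z : R) :
  pair_dist x z <= pair_dist x y + pair_dist y z.
Proof.
  unfold pair_dist; pose proof (nm_sub_triangle _ _ _ _ HK (F z) (F y) (F x)).
  pose proof (nm_sub_triangle _ _ _ _ HK (G z) (G y) (G x)); lra.
Qed.

Lemma pair_dist_le (x y : R) : pair_dist x y <= pair_norm x + pair_norm y.
Proof.
  unfold pair_dist, pair_norm; pose proof (nm_sub_le _ _ _ _ HK (F y) (F x)).
  pose proof (nm_sub_le _ _ _ _ HK (G y) (G x)); lra.
Qed.

Lemma pair_norm_lip (x y : R) : Rabs (pair_norm x - pair_norm y) <= pair_dist x y.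
Proof.
  unfold pair_dist, pair_norm; apply Rabs_le.
  pose proof (nm_le_sub _ _ _ _ HK (F y) (F x)).
  pose proof (nm_le_sub _ _ _ _ HK (G y) (G x)).
  pose proof (nm_le_sub _ _ _ _ HK (F x) (F y)) as H1.
  pose proof (nm_le_sub _ _ _ _ HK (G x) (G y)) as H2.
  rewrite (nm_sub_sym _ _ _ _ HK) in H1, H2; lra.
Qed.

Lemma pair_dist_bounded :
  BVp K sub nm p F -> BVp K sub nm p G ->
  exists M, forall E a b v, 0 <= a -> b <= 1 ->
    chain E (fun x y => powp (pair_dist x y) p) a b v -> v <= M.
Proof.
  intros (M1 & H1) (M2 & H2); exists (powp 3 p * M1 + powp 3 p * M2).
  intros E a b v Ha Hb Hc.
  apply chain_partition in Hc; auto.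
  - destruct Hc as (t & m & Ht & Hv).
    apply Rle_trans with (1 := Hv).
    apply Rle_trans with (powp 3 p * rsum (fun j => step_weight F (t j) (t (S j))) m
      + powp 3 p * rsum (fun j => step_weight G (t j) (t (S j))) m).
    + rewrite <- rsum_lin; apply rsum_le; intros i _.
      rewrite <- Rmult_plus_distr_l; apply powp_add_le; auto;
        try apply (nm_ge0 _ _ _ _ HK).
      apply Rle_refl.
    + pose proof (powp_ge0 p 3).
      apply Rplus_le_compat; apply Rmult_le_compat_l; auto;
        [apply H1|apply H2]; apply var_sumsP; now exists t, m.
  - intros; apply powp_ge0.
  - intros x; unfold pair_dist; rewrite !(nm_sub_diag _ _ _ _ HK), Rplus_0_r.
    apply powp_0.
Qed.

(** The scale [d] is fixed before [U], so one bad set serves both differences [F - F1] and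
    [G - G1]. *)
Lemma small_bad_variation (eps : R) :
  BVp K sub nm p F -> BVp K sub nm p G -> 0 < eps ->
  exists d, 0 < d /\ forall U : R -> K,
    (forall x, bad pair_norm d x -> nm (U x) <= 2 * d) ->
    (forall x, ~ bad pair_norm d x -> nm (U x) = 0) ->
    (forall x y, bad pair_norm d x -> bad pair_norm d y ->
      nm (sub (U y) (U x)) <= 2 * pair_dist x y) ->
    BVp K sub nm p U /\ BVp_norm K sub nm p U < eps.
Proof.
  intros HF HG Heps.
  destruct (pair_dist_bounded HF HG) as (M & HM).
  pose proof (powp_pos p (eps / 3) ltac:(lra)) as He.
  pose proof (powp_pos p 4 ltac:(lra)) as H4.
  (* The bound [eps / 6] gives [2 * d <= eps / 3] for the supremum. A switch changes [U] by at most
     [2 * d = 4 * (d / 2)], whence the factor 4; switch and [eta] terms each get half of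
     [powp (eps / 3) p]. *)
  destruct (powp_small p p_gt0 (powp 4 p) (powp (eps / 3) p / 2) (eps / 6))
    as (d0 & Hd0 & Hs0); try lra.
  set (eta := powp (eps / 3) p / (4 * powp 4 p)).
  assert (Heta : 0 < eta) by (apply Rdiv_lt_0_compat; lra).
  destruct (small_chains p pair_dist pair_norm p_gt0 pair_dist_ge0
    pair_dist_triangle pair_dist_le M HM eta d0) as (d & Hd & Hch); try lra.
  exists d; split; [lra|]; intros U Hb Hg Hbb.
  assert (Hvar : forall v, var_sums K sub nm p U v -> v <= powp (eps / 3) p).
  { intros v Hv; apply var_sumsP in Hv; destruct Hv as (t & m & Ht & ->).
    apply Rle_trans with (powp 4 p * (2 * eta + powp (d / 2) p)).
    - assert (Hd2 : forall x, nm (U x) <= 2 * d).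
      { intros x; destruct (classic (bad pair_norm d x)); auto.
        rewrite Hg by auto; lra. }
      apply bad_variation with (D := pair_dist) (r := pair_norm) (d := d);
        auto using pair_dist_le, pair_norm_lip; try lra.
      + intros x y Hx Hy; apply powp_scale_le; auto using pair_dist_ge0; [lra|].
        specialize (Hbb x y Hx Hy); pose proof (pair_dist_ge0 x y); lra.
      + intros x y Hx Hy; rewrite <- (powp_0 p); apply powp_le; auto.
        pose proof (nm_sub_le _ _ _ _ HK (U y) (U x)).
        rewrite !Hg in H by auto; lra.
      + intros x y Hx Hy; apply powp_scale_le; auto; try lra.
        pose proof (nm_sub_le _ _ _ _ HK (U y) (U x)).
        rewrite (Hg y Hy) in H; specialize (Hd2 x); lra.
      + intros x y Hx Hy; apply powp_scale_le; auto; try lra.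
        pose proof (nm_sub_le _ _ _ _ HK (U y) (U x)).
        rewrite (Hg x Hx) in H; specialize (Hd2 y); lra.
    - assert (powp (d / 2) p <= powp d0 p) by (apply powp_le; auto; lra).
      assert (Heq : powp 4 p * (2 * eta) = powp (eps / 3) p / 2)
        by (unfold eta; field; lra).
      nra. }
  split; [now exists (powp (eps / 3) p)|].
  apply BVp_norm_lt; auto.
  intros x _; destruct (classic (bad pair_norm d x)) as [H|H].
  - specialize (Hb x H); lra.
  - rewrite Hg by auto; lra.
Qed.

End Pair.

Lemma nondegenerate_approximation : thm4p3_for K sub mul nm p.
Proof.
  intros eps Heps F G HF HG.
  destruct (small_bad_variation F G eps HF HG Heps) as (d & Hd & HU).
  destruct (scalar_div _ _ _ _ HK d Hd) as (c & q & Hc & Hmul & Hq & Hqs).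
  set (isbad := badb (pair_norm F G) d).
  set (F1 := fun x => if isbad x then c else F x).
  set (G1 := fun x => if isbad x then q (mul (F x) (G x)) else G x).
  assert (HUF : BVp K sub nm p (fun x => sub (F x) (F1 x)) /\
    BVp_norm K sub nm p (fun x => sub (F x) (F1 x)) < eps).
  { apply HU; unfold F1, isbad.
    - intros x Hx; destruct (badP (pair_norm F G) d x); [|contradiction].
      apply bad_lt in Hx; unfold pair_norm in Hx.
      pose proof (nm_sub_le _ _ _ _ HK (F x) c).
      pose proof (nm_ge0 _ _ _ _ HK (G x)); lra.
    - intros x Hx; destruct (badP (pair_norm F G) d x); [contradiction|].
      apply (nm_sub_diag _ _ _ _ HK).
    - intros x y Hx Hy.
      destruct (badP (pair_norm F G) d x); [|contradiction].
      destruct (badP (pair_norm F G) d y); [|contradiction].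
      pose proof (nm_sub4_le _ _ _ _ HK (F y) c (F x) c) as H.
      rewrite (nm_sub_diag _ _ _ _ HK) in H.
      pose proof (pair_dist_ge0 F G x y).
      pose proof (nm_ge0 _ _ _ _ HK (sub (G y) (G x))).
      unfold pair_dist in *; lra. }
  assert (HUG : BVp K sub nm p (fun x => sub (G x) (G1 x)) /\
    BVp_norm K sub nm p (fun x => sub (G x) (G1 x)) < eps).
  { apply HU; unfold G1, isbad.
    - intros x Hx; destruct (badP (pair_norm F G) d x); [|contradiction].
      apply bad_lt in Hx; unfold pair_norm in Hx.
      pose proof (nm_sub_le _ _ _ _ HK (G x) (q (mul (F x) (G x)))) as H.
      rewrite Hq, (nm_mul _ _ _ _ HK) in H.
      pose proof (nm_ge0 _ _ _ _ HK (F x)); pose proof (nm_ge0 _ _ _ _ HK (G x)).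
      (* Both factors are below [d] at a bad point. *)
      assert (nm (F x) * nm (G x) / d <= d); [|lra].
      apply Rmult_le_reg_r with d; [lra|]; unfold Rdiv.
      rewrite Rmult_assoc, Rinv_l by lra; nra.
    - intros x Hx; destruct (badP (pair_norm F G) d x); [contradiction|].
      apply (nm_sub_diag _ _ _ _ HK).
    - intros x y Hx Hy.
      destruct (badP (pair_norm F G) d x); [|contradiction].
      destruct (badP (pair_norm F G) d y); [|contradiction].
      pose proof (nm_sub4_le _ _ _ _ HK (G y) (q (mul (F y) (G y)))
        (G x) (q (mul (F x) (G x)))) as H.
      rewrite Hqs in H.
      pose proof (nm_mul_sub _ _ _ _ HK (F y) (G y) (F x) (G x)) as H'.
      apply bad_lt in Hx; apply bad_lt in Hy; unfold pair_norm in Hx, Hy.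
      pose proof (nm_ge0 _ _ _ _ HK (F x)); pose proof (nm_ge0 _ _ _ _ HK (G x)).
      pose proof (nm_ge0 _ _ _ _ HK (F y)); pose proof (nm_ge0 _ _ _ _ HK (G y)).
      pose proof (nm_ge0 _ _ _ _ HK (sub (F y) (F x))).
      pose proof (nm_ge0 _ _ _ _ HK (sub (G y) (G x))).
      (* By the product rule [H'], with [nm (F y)] and [nm (G x)] below [d]: dividing by [d] is
         harmless on the bad set. *)
      assert (nm (sub (mul (F y) (G y)) (mul (F x) (G x))) / d <= pair_dist F G x y).
      { apply Rmult_le_reg_r with d; [lra|]; unfold Rdiv.
        rewrite Rmult_assoc, Rinv_l by lra; unfold pair_dist; nra. }
      unfold pair_dist in *; lra. }
  exists F1, G1; split; [now apply BVp_of_diff with F|].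
  split; [now apply BVp_of_diff with G|].
  split; [|split; [|split; [apply HUF|apply HUG]]].
  (* At bad points [F1] alone has modulus [d]; elsewhere [r] is at least [d / 2], the lower
     threshold of the hysteresis. *)
  - exists (d / 2); split; [lra|]; intros x Hx; unfold F1, G1, isbad.
    destruct (badP (pair_norm F G) d x) as [Hb|Hb].
    + pose proof (nm_ge0 _ _ _ _ HK (q (mul (F x) (G x)))); lra.
    + apply (not_bad_ge (pair_norm F G)); auto; lra.
  - intros x _; unfold F1, G1; destruct (isbad x); auto.
Qed.

End Scalar.

(* Both scalar fields F = R and F = C. *)
Theorem theorem4p3 (p : R) (hp : 1 <= p) :
  thm4p3_for R Rminus Rmult Rabs p /\ thm4p3_for Cpx Csub Cmul Cnorm p.
Proof.
  split; apply nondegenerate_approximation; try lra.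
  - exact scalar_field_R.
  - exact scalar_field_C.
Qed.
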